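(* Let $\mathcal{G}$ be a family of subsets of a set $X$. If $\mathcal{G}$ is isomorphic to a family of pseudoclopens of a connected compact space, then $\mathcal{G}$ is strongly irredundant, so in particular irredundant.
   Context: All compact spaces are Hausdorff. A pseudoclopen of a compact space $K$ is a pair $a=(a^-,a^+)$ with $a^-\subset K$ closed, $a^+\subset K$ open and $a^-\subset a^+$. Let $\mathcal{G}$ be a family of subsets of a set $X$. A bijection $\phi$ from $\mathcal{G}$ onto a family of pseudoclopens of $K$ is an isomorphism if for all $n,m$ and all distinct $a_1,\ldots,a_n,b_1,\ldots,b_m\in\mathcal{G}$: (1) if $\bigcap_{i\le n}a_i\setminus\bigcup_{j\le m}b_j=\emptyset$ then $\bigcap_{i\le n}\phi(a_i)^+\setminus\bigcup_{j\le m}\phi(b_j)^-=\emptyset$; (2) if $\bigcap_{i\le n}\phi(a_i)^-\setminus\bigcup_{j\le m}\phi(b_j)^+=\emptyset$ then $\bigcap_{i\le n}a_i\setminus\bigcup_{j\le m}b_j=\emptyset$. (Here $n$ or $m$ may be $0$; empty intersections are $X$, respectively $K$.) The family $\mathcal{G}$ is isomorphic to a family of pseudoclopens if such an isomorphism exists. For a family $\mathcal{F}$ of subsets of $X$, $\langle\mathcal{F}\rangle$ denotes the subalgebra of the power set of $X$ generated by $\mathcal{F}$. The family $\mathcal{G}$ is irredundant if $a\notin\langle\mathcal{G}\setminus\{a\}\rangle$ for every $a\in\mathcal{G}$; it is strongly irredundant if for all disjoint $\mathcal{F},\mathcal{F}'\subset\mathcal{G}$ the algebra $\langle\mathcal{F}\rangle\cap\langle\mathcal{F}'\rangle$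 is trivial, i.e. equal to $\{\emptyset,X\}$.
   Formalization: Strong irredundancy is proved as stated; ''in particular irredundant'' is proved only when neither ∅ nor X belongs to the family, since a family containing ∅ or X is never irredundant (e.g. {∅}, isomorphic to {(∅,∅)}). *)

(* Defs.v *)
From mathcomp Require Import all_boot.
From mathcomp Require Import all_classical topology measurable_structure.

Set Implicit Arguments.
Unset Strict Implicit.
Unset Printing Implicit Defensive.

Local Open Scope classical_set_scope.

Definition pseudoclopen (K : topologicalType) : set (set K * set K) :=
  [set a | [/\ closed a.1, open a.2 & a.1 `<=` a.2]].

(* The finite lists a_1, ..., a_n and b_1, ..., b_m are functions on 'I_n and
   'I_m; for n = 0 the intersection is setT, for m = 0 the union is set0. *)
Definition distinct_in (T : Type) (G : set T) (n m : nat)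
    (a : 'I_n -> T) (b : 'I_m -> T) : Prop :=
  [/\ (forall i, G (a i)) /\ (forall j, G (b j)),
      injective a, injective b & forall i j, a i <> b j].

(* Only the values of phi on G matter; H is the family of pseudoclopens. *)
Definition pseudoclopen_isomorphism (X : Type) (K : topologicalType)
    (G : set (set X)) (H : set (set K * set K))
    (phi : set X -> set K * set K) : Prop :=
  [/\ set_bij G H phi,
      (forall (n m : nat) (a : 'I_n -> set X) (b : 'I_m -> set X),
        distinct_in G a b ->
        \bigcap_i a i `\` \bigcup_j b j = set0 ->
        \bigcap_i (phi (a i)).2 `\` \bigcup_j (phi (b j)).1 = set0) &
      (forall (n m : nat) (a : 'I_n -> set X) (b : 'I_m -> set X),
        distinct_in G a b ->
        \bigcap_i (phi (a i)).1 `\` \bigcup_j (phi (b j)).2 = set0 ->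
        \bigcap_i a i `\` \bigcup_j b j = set0)].

Definition isomorphic_to_pseudoclopens (X : Type) (K : topologicalType)
    (G : set (set X)) : Prop :=
  exists (H : set (set K * set K)) (phi : set X -> set K * set K),
    H `<=` @pseudoclopen K /\ pseudoclopen_isomorphism G H phi.

Definition set_algebra (X : Type) (A : set (set X)) : Prop :=
  [/\ A set0, setC_closed A & setU_closed A].

Definition generated_algebra (X : Type) (F : set (set X)) : set (set X) :=
  smallest (@set_algebra X) F.

(* Every generated algebra contains set0 and setT, so a family that has one of
   them as a member is never irredundant. It can still be strongly irredundant:
   for instance [set set0] which, when X and K are nonempty, is isomorphic to
   the family consisting of the single pseudoclopen (set0, set0). *)
Definition irredundant (X : Type) (G : set (set X)) : Prop :=
  forall a, G a -> ~ generated_algebra (G `\ a) a.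

Definition strongly_irredundant (X : Type) (G : set (set X)) : Prop :=
  forall F F' : set (set X), F `<=` G -> F' `<=` G -> F `&` F' = set0 ->
    generated_algebra F `&` generated_algebra F' = [set set0; setT].

(* Main.v *)
(** Index the cells cut out by finitely many members of a family by the points
    [x] of [X].  If a nontrivial [C] depends only on a finite list [l] of
    members of [F], the cells [upper_cell phi l x] with [x] in [C], and those with [x] outside [C],
    form two nonempty open sets covering [K].  If [C] also depends only on a
    finite list [l'] from a disjoint [F'], then by (1) a cell of [l] with [x] in
    [C] never meets a cell of [l'] with [y] outside [C], and vice versa; as the
    cells of [l'] cover [K], the two open sets are disjoint, so [K] is
    disconnected. *)

Require Import Defs.
From mathcomp Require Import all_boot.
From mathcomp Require Import all_classical topology.

Local Open Scope classical_set_scope.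

(** Equivalently, [C] is a union of atoms of the finite algebra generated by [l]. *)
Definition determined_by {X : Type} (l : seq (set X)) (C : set X) : Prop :=
  forall x y, (forall a, a \in l -> a x = a y) -> C x = C y.

(** Each constraint takes the larger choice, $a^+$ or the complement of $a^-$: this makes cells open
    and lets them cover [K], at the price of possible overlaps. *)
Definition upper_cell {X K : Type} (phi : set X -> set K * set K)
    (l : seq (set X)) (x : X) : set K :=
  [set k | forall a, a \in l ->
    (a x -> (phi a).2 k) /\ (~ a x -> ~ (phi a).1 k)].

Lemma set_algebra_generated {X : Type} (F : set (set X)) :
  set_algebra (generated_algebra F).
Proof.
split.
- by move=> A [[A0 _ _] _].
- by move=> C FC A AF; have [[_ AN _] _] := AF; apply: AN; apply: FC.
- move=> C D FC FD A AF; have [[_ _ AU] _] := AF.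
  by apply: AU; [exact: FC|exact: FD].
Qed.

Lemma generated_algebra_trivial {X : Type} (F : set (set X)) :
  [set set0; setT] `<=` generated_algebra F.
Proof.
have [F0 FC _] := set_algebra_generated F.
by move=> _ [->|->] //; rewrite -setC0; apply: FC.
Qed.

(** The sets determined by finite lists from [F] form an algebra containing [F]; unions are handled
    by concatenating lists. *)
Lemma generated_algebra_determined {X : Type} {F : set (set X)} {C : set X} :
  generated_algebra F C ->
  exists l : seq (set X), (forall a, a \in l -> F a) /\ determined_by l C.
Proof.
move: C; apply: smallest_sub; first split.
- by exists [::].
- move=> C [l [lF lC]]; exists l; split=> // x y xy.
  by rewrite /setC /= (lC x y).
- move=> A B [l [lF lA]] [r [rF rB]]; exists (l ++ r); split.
    by move=> a; rewrite mem_cat => /orP[/lF|/rF].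
  move=> x y xy; rewrite /setU /= (lA x y) ?(rB x y) // => a al;
    by apply: xy; rewrite mem_cat al ?orbT.
- move=> a Fa; exists [:: a]; split=> [b|x y xy].
    by rewrite inE => /eqP ->.
  by apply: xy; rewrite mem_head.
Qed.

Lemma tnth_filter_mem {T : eqType} {l : seq T} {p : pred T}
    (i : 'I_(size [seq x <- l | p x])) :
  let x := tnth (in_tuple [seq x <- l | p x]) i in x \in l /\ p x.
Proof.
have := mem_tnth i (in_tuple [seq x <- l | p x]).
by rewrite mem_filter => /andP[].
Qed.

Lemma tnth_uniq_inj {T : eqType} {l : seq T} :
  uniq l -> injective (tnth (in_tuple l)).
Proof.
by move=> ul; apply/injectiveP; rewrite /injectiveb /dinjectiveb map_tnth_enum.
Qed.

Section Isomorphism.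
Context {X : Type} {K : topologicalType} {G : set (set X)}.
Context {H : set (set K * set K)} {phi : set X -> set K * set K}.
Hypothesis H_pseudoclopen : H `<=` @pseudoclopen K.
Hypothesis phi_iso : pseudoclopen_isomorphism G H phi.

Lemma iso_pseudoclopen (a : set X) : G a -> pseudoclopen (phi a).
Proof. by case: phi_iso => -[GH _ _] _ _ Ga; apply/H_pseudoclopen/GH. Qed.

Section Pattern.
Variables (l : seq (set X)) (P : set X -> Prop).
Hypothesis lG : forall a, a \in l -> G a.

(** A sign pattern [P] splits [l] into the two families of (1) and (2); [undup] provides the
    distinctness required there. *)
Let pos := [seq a <- undup l | `[< P a >]].
Let neg := [seq a <- undup l | ~~ `[< P a >]].

Let posP (i : 'I_(size pos)) :
  tnth (in_tuple pos) i \in l /\ P (tnth (in_tuple pos) i).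
Proof. by have [+ /asboolP] := tnth_filter_mem i; rewrite mem_undup. Qed.

Let negP (i : 'I_(size neg)) :
  tnth (in_tuple neg) i \in l /\ ~ P (tnth (in_tuple neg) i).
Proof. by have [+ /asboolPn] := tnth_filter_mem i; rewrite mem_undup. Qed.

Let pos_ex a : a \in l -> P a -> exists i, tnth (in_tuple pos) i = a.
Proof.
move=> al Pa; have /tnthP[i ->] : a \in in_tuple pos; last by exists i.
by rewrite mem_filter mem_undup al andbT; apply/asboolP.
Qed.

Let neg_ex a : a \in l -> ~ P a -> exists i, tnth (in_tuple neg) i = a.
Proof.
move=> al Pa; have /tnthP[i ->] : a \in in_tuple neg; last by exists i.
by rewrite mem_filter mem_undup al andbT; apply/asboolPn.
Qed.

Let pos_neg_distinct :
  distinct_in G (tnth (in_tuple pos)) (tnth (in_tuple neg)).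
Proof.
split.
- by split=> i; apply: lG; [case: (posP i)|case: (negP i)].
- exact/tnth_uniq_inj/filter_uniq/undup_uniq.
- exact/tnth_uniq_inj/filter_uniq/undup_uniq.
- by move=> i j ij; have [_] := negP j; rewrite -ij; case: (posP i).
Qed.

(** Contrapositive of (1): were the pattern realized by no point of [X], its upper version in [K]
    would be empty, yet it contains [k]. *)
Lemma pattern_upper (k : K) :
  (forall a, a \in l -> (P a -> (phi a).2 k) /\ (~ P a -> ~ (phi a).1 k)) ->
  exists x, forall a, a \in l -> a x <-> P a.
Proof.
move=> lk; case: phi_iso => _ /(_ _ _ _ _ pos_neg_distinct) iso _.
apply: contrapT => nox.
suff /iso/seteqP[+ _] : \bigcap_i tnth (in_tuple pos) i `\`
    \bigcup_j tnth (in_tuple neg) j = set0.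
  apply; split=> [i _|[j _]].
    by have [il Pi] := posP i; apply: (lk _ il).1.
  by have [jl Pj] := negP j; apply: (lk _ jl).2.
apply/seteqP; split=> // x [xpos xneg]; apply: nox; exists x => a al.
split=> [ax|/(pos_ex a al)[i <-]]; last exact: xpos.
by apply: contrapT => /(neg_ex a al)[j ja]; apply: xneg; exists j; rewrite ?ja.
Qed.

(** Contrapositive of (2), in the same way. *)
Lemma pattern_lower (x : X) :
  (forall a, a \in l -> a x <-> P a) ->
  exists k, forall a, a \in l ->
    (P a -> (phi a).1 k) /\ (~ P a -> ~ (phi a).2 k).
Proof.
move=> lx; case: phi_iso => _ _ /(_ _ _ _ _ pos_neg_distinct) iso.
apply: contrapT => nok.
suff /iso/seteqP[/(_ x) + _] : \bigcap_i (phi (tnth (in_tuple pos) i)).1 `\`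
    \bigcup_j (phi (tnth (in_tuple neg) j)).2 = set0.
  apply; split=> [i _|[j _]].
    by have [il Pi] := posP i; apply/(lx _ il).
  by have [jl Pj] := negP j => /(lx _ jl).
apply/seteqP; split=> // k [kpos kneg]; apply: nok; exists k => a al.
split=> [/(pos_ex a al)[i <-]|/(neg_ex a al)[j <-] kj]; first exact: kpos.
by apply: kneg; exists j.
Qed.

End Pattern.

Lemma upper_cell_open (l : seq (set X)) (x : X) :
  (forall a, a \in l -> G a) -> open (upper_cell phi l x).
Proof.
move=> lG.
have -> : upper_cell phi l x = \bigcap_(a in [set` l])
    (if `[< a x >] then (phi a).2 else ~` (phi a).1).
  apply/seteqP; split=> k kx a al; have := kx a al.
    by case: asboolP => [ax [/(_ ax)]|ax [_ /(_ ax)]].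
  by case: asboolP.
rewrite -closedC setC_bigcap; apply: closed_bigcup => [|a al].
  exact: finite_seq.
have [c o _] := iso_pseudoclopen a (lG a al).
by case: asboolP => _; rewrite ?setCK //; apply: open_closedC.
Qed.

(** By (2) even the smaller cell cut out by $a^-$ and the complements of $a^+$ has a point; it lies
    in the upper cell as $a^-\subset a^+$. *)
Lemma upper_cell_nonempty (l : seq (set X)) (x : X) :
  (forall a, a \in l -> G a) -> upper_cell phi l x !=set0.
Proof.
move=> lG; have [k lk] :=
  pattern_lower l (fun a => a x) lG x (fun a _ => iff_refl _).
exists k => a al; have [_ _ sub] := iso_pseudoclopen a (lG a al).
have [pos neg] := lk a al; split=> [ax|ax /sub]; last exact: neg.
by apply: sub; apply: pos.
Qed.

Lemma upper_cell_cover (l : seq (set X)) (k : K) :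
  (forall a, a \in l -> G a) -> exists x, upper_cell phi l x k.
Proof.
(* The pattern read off from $k\in a^+$ is admissible because $k\notin a^+$ forces $k\notin a^-$. *)
move=> lG; have [|x lx] := pattern_upper l (fun a => (phi a).2 k) lG k.
  move=> a al; split=> // nk /= k1; apply: nk.
  by have [_ _] := iso_pseudoclopen a (lG a al); apply.
exists x => a al; have ax := lx a al; split=> [/ax //|nax k1].
apply: nax; apply/ax.
by have [_ _] := iso_pseudoclopen a (lG a al); apply.
Qed.

(** As [F] and [F'] are disjoint, the signs of [x] on [l] and of [y] on [l'] glue to one pattern,
    which [k] satisfies. By (1) some [z] realizes it, and [C x = C z = C y]. *)
Lemma upper_cell_compatible {F F' : set (set X)} {C : set X}
    {l l' : seq (set X)} {x y : X} {k : K} :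
  F `<=` G -> F' `<=` G -> F `&` F' = set0 ->
  (forall a, a \in l -> F a) -> (forall a, a \in l' -> F' a) ->
  determined_by l C -> determined_by l' C ->
  upper_cell phi l x k -> upper_cell phi l' y k -> C x = C y.
Proof.
move=> FG F'G FF' lF lF' lC lC' kx ky.
have disj a : F' a -> ~ F a.
  by move=> F'a Fa; have : (F `&` F') a by []; rewrite FF'.
have [||z zP] :=
  pattern_upper (l ++ l') (fun a => F a /\ a x \/ ~ F a /\ a y) _ k.
- by move=> a; rewrite mem_cat => /orP[/lF/FG|/lF'/F'G].
- move=> a; rewrite mem_cat => /orP[al|al].
    have Fa := lF a al; have [p n] := kx a al; split; last by tauto.
    by case=> -[].
  have nFa := disj a (lF' a al).
  by have [p n] := ky a al; tauto.
rewrite (lC x z) ?(lC' z y) // => a al; apply/propext.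
  have nFa := disj a (lF' a al).
  by have := zP a; rewrite mem_cat al orbT => /(_ isT); tauto.
have Fa := lF a al.
by have := zP a; rewrite mem_cat al => /(_ isT); tauto.
Qed.

Lemma iso_strongly_irredundant :
  connected [set: K] -> strongly_irredundant G.
Proof.
move=> K_connected F F' FG F'G FF'; apply/seteqP; split; last first.
  by move=> A A01; split; apply: generated_algebra_trivial.
move=> C [/generated_algebra_determined[l [lF lC]]
          /generated_algebra_determined[l' [lF' lC']]].
have lG a : a \in l -> G a by move=> /lF/FG.
have lG' a : a \in l' -> G a by move=> /lF'/F'G.
have compat x y k : upper_cell phi l x k -> upper_cell phi l' y k -> C x = C y.
  exact: (upper_cell_compatible FG F'G FF' lF lF' lC lC').
have [[c Cc]|C0] := pselect (C !=set0); last first.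
  by left; apply/seteqP; split=> // x Cx; apply: C0; exists x.
right; apply/seteqP; split=> // d _; apply: contrapT => nCd.
pose W D := \bigcup_(x in D) upper_cell phi l x.
have W_open D : open (W D) by apply: bigcup_open => x _; apply: upper_cell_open.
have W_compl : W C = ~` W (~` C).
  apply/seteqP; split=> k.
    (* [compat] relates only a cell of [l] to a cell of [l'], so two cells of [l] through [k] are
       compared via a cell of [l'] containing [k]. *)
    move=> [x Cx kx] [y nCy ky]; have [z kz] := upper_cell_cover l' k lG'.
    by apply: nCy; rewrite (compat _ _ _ ky kz) -(compat _ _ _ kx kz).
  move=> nk; have [z kz] := upper_cell_cover l k lG; exists z => //.
  by apply: contrapT => nCz; apply: nk; exists z.
have WT : W C = setT.
  apply: K_connected.
  - by have [k kc] := upper_cell_nonempty l c lG; exists k, c.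
  - by exists (W C); rewrite ?setTI.
  - by exists (W C); rewrite ?setTI // W_compl; apply: open_closedC.
have [k kd] := upper_cell_nonempty l d lG.
have : W C k by rewrite WT.
by rewrite W_compl; apply; exists d.
Qed.

End Isomorphism.

(** Apply strong irredundancy to [[set a]] and the rest of [G]: a redundant [a] lies in both
    algebras, hence is [set0] or [setT]. *)
Lemma strongly_irredundant_irredundant {X : Type} {G : set (set X)} :
  strongly_irredundant G -> ~ G set0 -> ~ G setT -> irredundant G.
Proof.
move=> sG G0 GT a Ga aG.
have : (generated_algebra [set a] `&` generated_algebra (G `\ a)) a.
  by split=> // A [_]; apply.
rewrite sG => [[aE|aE]|||].
- by apply: G0; rewrite -aE.
- by apply: GT; rewrite -aE.
- by move=> _ ->.
- exact: subDsetl.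
- exact: setDIK.
Qed.

Theorem corollary3p9 (X : Type) (G : set (set X)) (K : topologicalType)
    (K_compact : compact [set: K]) (K_hausdorff : hausdorff_space K)
    (K_connected : connected [set: K])
    (G_iso : isomorphic_to_pseudoclopens K G) :
  strongly_irredundant G /\
  (~ G set0 -> ~ G setT -> irredundant G).
Proof.
have [H [phi [H_pseudoclopen phi_iso]]] := G_iso.
have sG := iso_strongly_irredundant H_pseudoclopen phi_iso K_connected.
by split=> //; apply: strongly_irredundant_irredundant.
Qed.
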